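(* In the Call-by-Value probabilistic $\lambda$-calculus (as defined in the context), for each multi-distribution $\mathbf m$: 1. $[\![\mathbf m]\!]$ is defined, i.e. $\mathrm{Lim}_{\mathrm{obs}_{\mathrm{Nnf}}}(\mathbf m,\Rightarrow)$ has a greatest element; 2. for every subdistribution $\mathbf r$: $\mathbf m\Rrightarrow_E^{\mathrm{obs}_{\mathrm{Nnf}}}\mathbf r$ if and only if $\mathbf r=[\![\mathbf m]\!]$. Hence $\Rrightarrow_E$ is an $\mathrm{obs}_{\mathrm{Nnf}}$-normalizing strategy for $\Rightarrow$.
   Context: Terms $\Lambda_\oplus$: $M::=x\mid\lambda x.M\mid MM\mid M\oplus M$; values $V::=x\mid\lambda x.M$. Contexts $C::=[\,]\mid MC\mid CM\mid\lambda x.C\mid C\oplus M\mid M\oplus C$; weak contexts $W::=[\,]\mid WM\mid MW$. A multi-distribution is a finite multiset $[p_iM_i]_{i\in I}$ with $p_i\in(0,1]$, $\sum_ip_i\le1$; $+$ is multiset union, $q\cdot[p_iM_i]_i=[(qp_i)M_i]_i$, $[M]:=[1M]$. $C[(\lambda x.M)V]\to_{\beta_v}[C[M\{V/x\}]]$; $W[M\oplus N]\to_\oplus[\tfrac12W[M],\tfrac12W[N]]$; $\to:=\to_{\beta_v}\cup\to_\oplus$; surface reduction $\to_s$ is $\to_\oplus$ together with the closure of $\beta_v$ under weak contexts. $M$ is $\to$-normal (surface-normal) if no $\mathbf m$ with $M\to\mathbf m$ ($M\to_s\mathbf m$); $\mathrm{Nnf}$ is the set of $\to$-normal terms. Lifting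 $\Rightarrow_r$ of $r$: least relation with $[M]\Rightarrow_r[M]$; $[M]\Rightarrow_r\mathbf m$ if $M\,r\,\mathbf m$; $[p_iM_i]_{i\in I}\Rightarrow_r\sum_ip_i\cdot\mathbf m_i$ if $[M_i]\Rightarrow_r\mathbf m_i$ for all $i$. Full lifting $\Rrightarrow_r$: same, but $[M]\Rrightarrow_r[M]$ only when $M$ is $\to$-normal. $\Rightarrow$ is the lifting of $\to$. Let $\rightsquigarrow_U$ be the unbiased iteration of weak $\beta_v$-reduction on $\Lambda_\oplus$: if $M\to_wM'$ (closure of $\beta_v$ under weak contexts) then $M\rightsquigarrow_UM'$; if $M$ is $\to_w$-normal: $\lambda x.P\rightsquigarrow_U\lambda x.P'$, $PQ\rightsquigarrow_UP'Q$, $PQ\rightsquigarrow_UPQ'$, $P\oplus Q\rightsquigarrow_UP'\oplus Q$, $P\oplus Q\rightsquigarrow_UP\oplus Q'$ whenever $P\rightsquigarrow_UP'$, resp. $Q\rightsquigarrow_UQ'$. $\rightsquigarrow_E$: if $M$ is not surface-normal and $M\to_s\mathbf m$ then $M\rightsquigarrow_E\mathbf m$; if $M$ is surface-normal and $M\rightsquigarrow_UM'$ then $M\rightsquigarrow_E[M']$; $\Rrightarrow_E$ is its full lifting. $\mathrm{obs}_{\mathrm{Nnf}}([p_iM_i]_{i\in I})$ is the subdistribution $\mu$ on $\mathrm{Nnf}$ with $\mu(N)=\sum_{i:\,M_i=N}p_i$, ordered pointwise. For $R$ a relation on multi-distributions, $\mathbf m\,R^{\mathrm{obs}_{\mathrm{Nnf}}}\,\mathbf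 r$ means there is a maximal $R$-sequence $(\mathbf m_n)_n$ from $\mathbf m$ (infinite, or finite ending in an $R$-normal element and then continued constantly) with $\sup_n\mathrm{obs}_{\mathrm{Nnf}}(\mathbf m_n)=\mathbf r$; $\mathrm{Lim}_{\mathrm{obs}_{\mathrm{Nnf}}}(\mathbf m,R)$ is the set of such $\mathbf r$; $[\![\mathbf m]\!]$ is the greatest element of $\mathrm{Lim}_{\mathrm{obs}_{\mathrm{Nnf}}}(\mathbf m,\Rightarrow)$. A subrelation $R'\subseteq R$ is $\mathrm{obs}_{\mathrm{Nnf}}$-normalizing for $R$ if it is asymptotically complete ($\mathbf m R^{\mathrm{obs}}\mathbf q$ implies $\mathbf m R'^{\mathrm{obs}}\mathbf p$ for some $\mathbf p\ge\mathbf q$) and asymptotically uniform (every element of $\mathrm{Lim}(\mathbf m,R')$ is maximal in $\mathrm{Lim}(\mathbf m,R')$), for all $\mathbf m$. *)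

(* Defs.v *)
From Stdlib Require Import Reals List Permutation Arith ClassicalDescription.
Import ListNotations.
Open Scope R_scope.

Inductive term : Type :=
| Var : nat -> term
| Lam : term -> term
| App : term -> term -> term
| Choice : term -> term -> term.

Definition term_eq_dec : forall M N : term, {M = N} + {M <> N}.
Proof. decide equality; apply Nat.eq_dec. Defined.

Definition is_value (V : term) : Prop :=
  match V with Var _ | Lam _ => True | _ => False end.

Fixpoint shift (d c : nat) (M : term) : term :=
  match M with
  | Var n => if Nat.ltb n c then Var n else Var (n + d)
  | Lam P => Lam (shift d (S c) P)
  | App P Q => App (shift d c P) (shift d c Q)
  | Choice P Q => Choice (shift d c P) (shift d c Q)
  end.

Fixpoint substk (k : nat) (V : term) (M : term) : term :=
  match M with
  | Var n => if Nat.ltb n k then Var n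
             else if Nat.eqb n k then shift k 0 V else Var (n - 1)
  | Lam P => Lam (substk (S k) V P)
  | App P Q => App (substk k V P) (substk k V Q)
  | Choice P Q => Choice (substk k V P) (substk k V Q)
  end.

Definition subst0 (V M : term) : term := substk 0 V M.

Inductive ctx : Type :=
| CHole : ctx
| CAppR : term -> ctx -> ctx
| CAppL : ctx -> term -> ctx
| CLam : ctx -> ctx
| CChoiceL : ctx -> term -> ctx
| CChoiceR : term -> ctx -> ctx.

Fixpoint plug (C : ctx) (T : term) : term :=
  match C with
  | CHole => T
  | CAppR M C' => App M (plug C' T)
  | CAppL C' M => App (plug C' T) M
  | CLam C' => Lam (plug C' T)
  | CChoiceL C' M => Choice (plug C' T) M
  | CChoiceR M C' => Choice M (plug C' T)
  end.

Inductive wctx : Type :=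
| WHole : wctx
| WAppL : wctx -> term -> wctx
| WAppR : term -> wctx -> wctx.

Fixpoint wplug (W : wctx) (T : term) : term :=
  match W with
  | WHole => T
  | WAppL W' M => App (wplug W' T) M
  | WAppR M W' => App M (wplug W' T)
  end.

(** * Multi-distributions: a list of (probability, term) pairs, read as a
    finite multiset (relations below are closed under permutation). *)
Definition mdist := list (R * term).

Definition mass (m : mdist) : R := fold_right Rplus 0 (map fst m).

Definition valid_mdist (m : mdist) : Prop :=
  Forall (fun pM => 0 < fst pM <= 1) m /\ mass m <= 1.

Definition scale (q : R) (m : mdist) : mdist :=
  map (fun pM => (q * fst pM, snd pM)) m.

Definition dirac (M : term) : mdist := [(1, M)].

Definition beta_v_step (M : term) (m : mdist) : Prop :=
  exists C P V, is_value V /\ M = plug C (App (Lam P) V) /\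
                m = dirac (plug C (subst0 V P)).

Definition oplus_step (M : term) (m : mdist) : Prop :=
  exists W P Q, M = wplug W (Choice P Q) /\
                m = [(1/2, wplug W P); (1/2, wplug W Q)].

Definition step (M : term) (m : mdist) : Prop :=
  beta_v_step M m \/ oplus_step M m.

Definition wstep (M M' : term) : Prop :=
  exists W P V, is_value V /\ M = wplug W (App (Lam P) V) /\
                M' = wplug W (subst0 V P).

Definition sstep (M : term) (m : mdist) : Prop :=
  oplus_step M m \/ exists M', wstep M M' /\ m = dirac M'.

Definition Nnf (M : term) : Prop := ~ exists m, step M m.
Definition snormal (M : term) : Prop := ~ exists m, sstep M m.
Definition wnormal (M : term) : Prop := ~ exists M', wstep M M'.

Inductive ustep : term -> term -> Prop :=
| U_w : forall M M', wstep M M' -> ustep M M'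
| U_lam : forall P P', wnormal (Lam P) -> ustep P P' -> ustep (Lam P) (Lam P')
| U_appl : forall P P' Q, wnormal (App P Q) -> ustep P P' -> ustep (App P Q) (App P' Q)
| U_appr : forall P Q Q', wnormal (App P Q) -> ustep Q Q' -> ustep (App P Q) (App P Q')
| U_chl : forall P P' Q, wnormal (Choice P Q) -> ustep P P' ->
    ustep (Choice P Q) (Choice P' Q)
| U_chr : forall P Q Q', wnormal (Choice P Q) -> ustep Q Q' ->
    ustep (Choice P Q) (Choice P Q').

Definition estep (M : term) (m : mdist) : Prop :=
  (~ snormal M /\ sstep M m) \/
  (snormal M /\ exists M', ustep M M' /\ m = dirac M').

Definition lift_one (full : bool) (r : term -> mdist -> Prop) (M : term) (m : mdist) : Prop :=
  (m = dirac M /\ (full = true -> Nnf M)) \/ r M m.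

Fixpoint combine_scaled (l : mdist) (ms : list mdist) : mdist :=
  match l, ms with
  | (p, _) :: l', mi :: ms' => scale p mi ++ combine_scaled l' ms'
  | _, _ => []
  end.

Definition lift_gen (full : bool) (r : term -> mdist -> Prop) (m m' : mdist) : Prop :=
  exists ms : list mdist,
    Forall2 (fun pM mi => lift_one full r (snd pM) mi) m ms /\
    Permutation m' (combine_scaled m ms).

Definition lift (r : term -> mdist -> Prop) := lift_gen false r.
Definition full_lift (r : term -> mdist -> Prop) := lift_gen true r.

Definition Step := lift step.
Definition EStep := full_lift estep.

Definition subdist := term -> R.

Definition obs (m : mdist) : subdist := fun N =>
  if excluded_middle_informative (Nnf N) then
    fold_right Rplus 0
      (map (fun pM => if term_eq_dec (snd pM) N then fst pM else 0) m)
  else 0.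

Definition is_subdist (r : subdist) : Prop :=
  (forall N, 0 <= r N) /\ (forall N, ~ Nnf N -> r N = 0) /\
  (forall l : list term, NoDup l -> fold_right Rplus 0 (map r l) <= 1).

Definition sub_le (r q : subdist) : Prop := forall N, r N <= q N.

Definition rel_normal (Rl : mdist -> mdist -> Prop) (m : mdist) : Prop :=
  ~ exists m', Rl m m'.

(* maximal R-sequence from m (infinite, or ending in an R-normal element
   and then continued constantly) *)
Definition max_seq (Rl : mdist -> mdist -> Prop) (m : mdist) (s : nat -> mdist) : Prop :=
  s O = m /\
  forall n, Rl (s n) (s (S n)) \/ (rel_normal Rl (s n) /\ s (S n) = s n).

Definition obs_rel (Rl : mdist -> mdist -> Prop) (m : mdist) (r : subdist) : Prop :=
  exists s, max_seq Rl m s /\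
    forall N, is_lub (fun x => exists n, x = obs (s n) N) (r N).

Definition Lim (m : mdist) (Rl : mdist -> mdist -> Prop) (r : subdist) : Prop :=
  obs_rel Rl m r.

Definition greatest_Lim (m : mdist) (Rl : mdist -> mdist -> Prop) (d : subdist) : Prop :=
  Lim m Rl d /\ forall q, Lim m Rl q -> sub_le q d.

Definition denot (m : mdist) (d : subdist) : Prop := greatest_Lim m Step d.

Definition asymp_complete (R' Rl : mdist -> mdist -> Prop) : Prop :=
  forall m, valid_mdist m -> forall q, obs_rel Rl m q ->
    exists p, obs_rel R' m p /\ sub_le q p.

Definition asymp_uniform (R' : mdist -> mdist -> Prop) : Prop :=
  forall m, valid_mdist m -> forall p, Lim m R' p ->
    forall p', Lim m R' p' -> sub_le p p' -> p' = p.

Definition obs_normalizing (R' Rl : mdist -> mdist -> Prop) : Prop :=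
  (forall m m', R' m m' -> Rl m m') /\ asymp_complete R' Rl /\ asymp_uniform R'.

(* Main.v *)
Require Import Defs.
From Stdlib Require Import Reals List.
From Stdlib Require Import Permutation Arith Lia Lra Relations Operators_Properties.
From Stdlib Require Import ClassicalDescription IndefiniteDescription FunctionalExtensionality.
Import ListNotations.
Open Scope R_scope.

(** Every [EStep]-sequence dominates every [Step]-sequence: if some finite
    [Step]-reduction observes the normal form [N] with probability [r], then
    along any [EStep]-sequence [N] is eventually observed with probability at
    least [r].  Applied to two [EStep]-sequences this gives uniqueness of the
    limit, and applied to arbitrary [Step]-sequences that it is the greatest one.

    Two facts suffice.  Standardization in the style of Kashima: beta-steps
    anywhere are absorbed into a relation [std] whose top-level part consists of
    weak steps, and [std] commutes with the choice steps and becomes an unbiased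
    reduction when its target is normal; hence an arbitrary evaluation tree to [N]
    turns into a tree of E-steps of the same probability.  Random descent:
    E-steps satisfy the diamond property, where diverging steps are joined by
    exactly one step on each side, so every E-step brings [N] one step closer. *)

Ltac nat_cases :=
  repeat match goal with
  | |- context [Nat.ltb ?a ?b] => destruct (Nat.ltb_spec a b)
  | |- context [Nat.eqb ?a ?b] => destruct (Nat.eqb_spec a b)
  end.

(** * Substitution *)

(** After the inner shift no free index lies in the gap from [c] to [c + m], so every cutoff [i] in
    that range separates the same indices as [c] does. *)
Lemma shift_shift_merge (M : term) : forall j m i c, (c <= i <= c + m)%nat ->
  shift j i (shift m c M) = shift (j + m) c M.
Proof.
  induction M as [n|P IH|P IHP Q IHQ|P IHP Q IHQ]; intros j m i c Hi; simpl.
  - nat_cases; simpl; nat_cases; try lia; f_equal; lia.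
  - f_equal. apply IH. lia.
  - f_equal; auto.
  - f_equal; auto.
Qed.

Lemma shift_shift_comm (M : term) : forall d k i c,
  shift d (i + k + c) (shift k i M) = shift k i (shift d (i + c) M).
Proof.
  induction M as [n|P IH|P IHP Q IHQ|P IHP Q IHQ]; intros d k i c; simpl.
  - nat_cases; simpl; nat_cases; try lia; f_equal; lia.
  - f_equal. apply (IH d k (S i) c).
  - f_equal; auto.
  - f_equal; auto.
Qed.

(** [substk] keeps [V] unshifted until a variable is hit, so the cutoff for [V] ignores the [k]
    binders crossed, while the one for [P] counts them and the substituted variable. *)
Lemma shift_substk (P V : term) : forall d k c,
  shift d (k + c) (substk k V P) = substk k (shift d c V) (shift d (S (k + c)) P).
Proof.
  induction P as [n|P IH|P IHP Q IHQ|P IHP Q IHQ]; intros d k c; simpl.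
  - nat_cases; simpl; nat_cases; try lia; try (f_equal; lia).
    apply (shift_shift_comm V d k 0 c).
  - f_equal. apply (IH d (S k) c).
  - f_equal; auto.
  - f_equal; auto.
Qed.

(** The index [c + j] falls in the gap opened by the shift and never occurs; the substitution merely
    narrows that gap by one. *)
Lemma substk_shift_cancel (M U : term) : forall c j m, (j <= m)%nat ->
  substk (c + j) U (shift (S m) c M) = shift m c M.
Proof.
  induction M as [n|P IH|P IHP Q IHQ|P IHP Q IHQ]; intros c j m Hj; simpl.
  - nat_cases; simpl; nat_cases; try lia; f_equal; lia.
  - f_equal. apply (IH (S c) j m Hj).
  - f_equal; auto.
  - f_equal; auto.
Qed.

Lemma substk_shift_comm (M V : term) : forall i j k,
  substk (i + j + k) V (shift j i M) = shift j i (substk (i + k) V M).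
Proof.
  induction M as [n|P IH|P IHP Q IHQ|P IHP Q IHQ]; intros i j k; simpl.
  - nat_cases; simpl; nat_cases; try lia; try (f_equal; lia).
    rewrite shift_shift_merge by lia. f_equal; lia.
  - f_equal. apply (IH (S i) j k).
  - f_equal; auto.
  - f_equal; auto.
Qed.

Lemma substk_substk (P U V : term) : forall j k,
  substk (j + k) V (substk j U P) =
  substk j (substk k V U) (substk (S (j + k)) V P).
Proof.
  induction P as [n|P IH|P IHP Q IHQ|P IHP Q IHQ]; intros j k.
  - cbn [substk]; nat_cases; cbn [substk]; nat_cases; try lia; try reflexivity.
    (* The variable is [j], the one replaced by [U]; in the next bullet it is [S (j + k)], the one
       replaced by [V]. *)
    + apply (substk_shift_comm U V 0 j k).
    + symmetry. apply (substk_shift_cancel V (substk k V U) 0 j (j + k)). lia.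
  - cbn [substk]. f_equal. apply (IH (S j) k).
  - simpl; f_equal; auto.
  - simpl; f_equal; auto.
Qed.

Lemma is_value_shift (V : term) d c : is_value V -> is_value (shift d c V).
Proof. destruct V; simpl; nat_cases; simpl; auto. Qed.

Lemma is_value_substk (U V : term) k :
  is_value V -> is_value U -> is_value (substk k V U).
Proof.
  intros HV. destruct U; simpl; nat_cases; simpl; auto using is_value_shift.
Qed.

(** * Inductive presentations of the reductions *)

Inductive beta : term -> term -> Prop :=
| beta_root P V : is_value V -> beta (App (Lam P) V) (subst0 V P)
| beta_lam P P' : beta P P' -> beta (Lam P) (Lam P')
| beta_appl P P' Q : beta P P' -> beta (App P Q) (App P' Q)
| beta_appr P Q Q' : beta Q Q' -> beta (App P Q) (App P Q')
| beta_chl P P' Q : beta P P' -> beta (Choice P Q) (Choice P' Q)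
| beta_chr P Q Q' : beta Q Q' -> beta (Choice P Q) (Choice P Q').

Inductive wbeta : term -> term -> Prop :=
| wbeta_root P V : is_value V -> wbeta (App (Lam P) V) (subst0 V P)
| wbeta_appl P P' Q : wbeta P P' -> wbeta (App P Q) (App P' Q)
| wbeta_appr P Q Q' : wbeta Q Q' -> wbeta (App P Q) (App P Q').

(** The two outcomes are kept in order and without their weights 1/2, so that diamonds can be stated
    branch by branch. *)
Inductive choose : term -> term -> term -> Prop :=
| choose_root P Q : choose (Choice P Q) P Q
| choose_appl M P Q A : choose M P Q -> choose (App M A) (App P A) (App Q A)
| choose_appr M P Q A : choose M P Q -> choose (App A M) (App A P) (App A Q).

Lemma beta_v_step_iff M m :
  beta_v_step M m <-> exists M', beta M M' /\ m = dirac M'.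
Proof.
  split.
  - intros (C & P & V & HV & -> & ->). eexists; split; [|reflexivity].
    induction C; simpl; constructor; auto.
  - intros (M' & H & ->).
    enough (exists C P V, is_value V /\ M = plug C (App (Lam P) V) /\
              M' = plug C (subst0 V P)) as (C & P & V & HV & -> & ->)
      by (exists C, P, V; auto).
    induction H as [P V HV | P P' H IH | P P' Q H IH | P Q Q' H IH
                   | P P' Q H IH | P Q Q' H IH];
      [ exists CHole, P, V; auto | .. ];
      destruct IH as (C & A & V & HV & -> & ->);
      [ exists (CLam C) | exists (CAppL C Q) | exists (CAppR P C)
      | exists (CChoiceL C Q) | exists (CChoiceR P C) ]; exists A, V; auto.
Qed.

Lemma wstep_iff M M' : wstep M M' <-> wbeta M M'.
Proof.
  split.
  - intros (W & P & V & HV & -> & ->).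
    induction W; simpl; constructor; auto.
  - intros H.
    induction H as [P V HV | P P' Q H IH | P Q Q' H IH];
      [ exists WHole, P, V; auto | .. ];
      destruct IH as (W & A & V & HV & -> & ->);
      [ exists (WAppL W Q) | exists (WAppR P W) ]; exists A, V; auto.
Qed.

Lemma oplus_step_iff M m :
  oplus_step M m <-> exists P Q, choose M P Q /\ m = [(1/2, P); (1/2, Q)].
Proof.
  split.
  - intros (W & P & Q & -> & ->). do 2 eexists; split; [|reflexivity].
    induction W; simpl; constructor; auto.
  - intros (P & Q & H & ->).
    enough (exists W A B, M = wplug W (Choice A B) /\
              P = wplug W A /\ Q = wplug W B) as (W & A & B & -> & -> & ->)
      by (exists W, A, B; auto).
    induction H as [P Q | M P Q A H IH | M P Q A H IH];
      [ exists WHole, P, Q; auto | .. ];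
      destruct IH as (W & B & C & -> & -> & ->);
      [ exists (WAppL W A) | exists (WAppR A W) ]; exists B, C; auto.
Qed.

Lemma wbeta_beta M M' : wbeta M M' -> beta M M'.
Proof. induction 1; constructor; auto. Qed.

Lemma ustep_beta M M' : ustep M M' -> beta M M'.
Proof.
  induction 1; try (constructor; assumption).
  apply wbeta_beta, wstep_iff; assumption.
Qed.

Lemma step_iff M m : step M m <->
  (exists M', beta M M' /\ m = dirac M') \/
  (exists P Q, choose M P Q /\ m = [(1/2, P); (1/2, Q)]).
Proof. unfold step. rewrite beta_v_step_iff, oplus_step_iff. reflexivity. Qed.

Lemma wnormal_iff M : wnormal M <-> forall M', ~ wbeta M M'.
Proof.
  unfold wnormal. split.
  - intros H M' HM. apply H. exists M'. apply wstep_iff, HM.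
  - intros H (M' & HM). apply (H M'), wstep_iff, HM.
Qed.

Lemma snormal_iff M : snormal M <->
  (forall M', ~ wbeta M M') /\ (forall P Q, ~ choose M P Q).
Proof.
  unfold snormal, sstep. split.
  - intros H. split.
    + intros M' HM. apply H. eexists. right. exists M'.
      split; [apply wstep_iff, HM|reflexivity].
    + intros P Q HM. apply H. eexists. left. apply oplus_step_iff; eauto.
  - intros [Hw Hc] (m & [Hm|(M' & Hm & _)]).
    + apply oplus_step_iff in Hm as (P & Q & Hm & _). exact (Hc _ _ Hm).
    + apply wstep_iff in Hm. exact (Hw _ Hm).
Qed.

Lemma Nnf_iff M : Nnf M <->
  (forall M', ~ beta M M') /\ (forall P Q, ~ choose M P Q).
Proof.
  unfold Nnf. split.
  - intros H. split.
    + intros M' HM. apply H. eexists. apply step_iff; eauto.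
    + intros P Q HM. apply H. eexists. apply step_iff; eauto 6.
  - intros [Hb Hc] (m & Hm).
    apply step_iff in Hm as [(M' & Hm & _)|(P & Q & Hm & _)];
      [exact (Hb _ Hm)|exact (Hc _ _ Hm)].
Qed.

Lemma value_wnormal V M : is_value V -> ~ wbeta V M.
Proof. intros HV H. destruct H; exact HV. Qed.

Lemma value_no_choose V P Q : is_value V -> ~ choose V P Q.
Proof. intros HV H. destruct H; exact HV. Qed.

(** The E-steps with a Dirac outcome. A weak step carries no side condition, because its existence
    already refutes surface normality. *)
Definition ebeta (M M' : term) : Prop := wbeta M M' \/ (snormal M /\ ustep M M').

Lemma estep_iff M m : estep M m <->
  (exists M', ebeta M M' /\ m = dirac M') \/
  (exists P Q, choose M P Q /\ m = [(1/2, P); (1/2, Q)]).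
Proof.
  unfold estep, ebeta. split.
  - intros [[_ [H|(M' & H & ->)]]|[Hn (M' & H & ->)]].
    + right. apply oplus_step_iff, H.
    + left. exists M'. split; [left; apply wstep_iff, H|reflexivity].
    + left. exists M'. auto.
  - intros [(M' & [H|[Hn H]] & ->)|H].
    + left. assert (sstep M (dirac M')) as Hs
        by (right; exists M'; split; [apply wstep_iff, H|reflexivity]).
      split; [|exact Hs]. intros Hn. apply Hn. eauto.
    + right. eauto.
    + left. apply oplus_step_iff in H.
      assert (sstep M m) as Hs by (left; exact H).
      split; [|exact Hs]. intros Hn. apply Hn. eauto.
Qed.

Lemma ebeta_beta M M' : ebeta M M' -> beta M M'.
Proof. intros [H|[_ H]]; auto using wbeta_beta, ustep_beta. Qed.

Lemma estep_step M m : estep M m -> step M m.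
Proof.
  rewrite estep_iff, step_iff.
  intros [(M' & H & ->)|H]; [left; eauto using ebeta_beta|right; exact H].
Qed.

(** Unbiased reduction never gets stuck early: either the whole term has a weak step, or it is
    weakly normal and the step found inside the subterm is allowed. *)
Lemma beta_ustep M M' : beta M M' -> exists M'', ustep M M''.
Proof.
  induction 1 as [P V HV | P P' H [R HR] | P P' Q H [R HR] | P Q Q' H [R HR]
                 | P P' Q H [R HR] | P Q Q' H [R HR]].
  1: { eexists. apply U_w, wstep_iff. constructor; exact HV. }
  all: match goal with |- exists _, ustep ?M _ =>
         destruct (classic (wnormal M)) as [Hn|Hn];
         [| apply NNPP in Hn as (M' & Hn); exists M'; apply U_w, Hn] end.
  all: eauto using ustep.
Qed.

Lemma estep_exists M : ~ Nnf M -> exists m, estep M m.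
Proof.
  intros H. destruct (classic (snormal M)) as [Hs|Hs].
  - apply NNPP in H as (m & Hm).
    apply step_iff in Hm as [(M' & Hm & _)|(P & Q & Hm & _)].
    + apply beta_ustep in Hm as (M'' & Hu). exists (dirac M'').
      right. eauto.
    + apply snormal_iff in Hs as [_ Hs]. destruct (Hs _ _ Hm).
  - assert (Hs' := Hs). apply NNPP in Hs' as (m & Hm). exists m. left. auto.
Qed.

(** * Diamond properties *)

(** Values have no weak steps, so distinct weak redexes are disjoint: contracting one neither copies
    nor erases the other, and a single step on each side closes the diagram. *)
Lemma wbeta_diamond M A : wbeta M A -> forall B, wbeta M B ->
  A = B \/ exists D, wbeta A D /\ wbeta B D.
Proof.
  induction 1 as [P V HV | P P' Q H IH | P Q Q' H IH]; intros B HB;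
    inversion HB; subst.
  all: try match goal with
    | HL : wbeta (Lam _) _ |- _ => destruct (value_wnormal (Lam _) _ I HL)
    | HV : is_value ?V, HW : wbeta ?V _ |- _ => destruct (value_wnormal _ _ HV HW) end.
  all: auto.
  2, 3: right; eexists; split; constructor; eassumption.
  all: match goal with H : wbeta ?P ?B |- App _ _ = _ \/ _ =>
         destruct (IH _ H) as [->|(D & Ha & Hb)];
         [left; reflexivity|right; eexists; split; constructor; eassumption] end.
Qed.

Lemma wbeta_choose_diamond M A : wbeta M A -> forall P Q, choose M P Q ->
  exists P' Q', choose A P' Q' /\ wbeta P P' /\ wbeta Q Q'.
Proof.
  induction 1 as [R V HV | R R' S H IH | R S S' H IH]; intros P Q HC;
    inversion HC; subst.
  all: try match goal with
    | HL : choose (Lam _) _ _ |- _ => destruct (value_no_choose (Lam _) _ _ I HL)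
    | HV : is_value ?V, HW : choose ?V _ _ |- _ =>
        destruct (value_no_choose _ _ _ HV HW) end.
  2, 3: do 2 eexists; repeat split; constructor; eassumption.
  all: match goal with H : choose _ _ _ |- _ =>
         destruct (IH _ _ H) as (P' & Q' & Ha & Hb & Hc);
         do 2 eexists; repeat split; constructor; eassumption end.
Qed.

(** Two disjoint surface choices give four outcomes; performing them in the other order transposes
    the two-by-two table. *)
Lemma choose_diamond M P Q : choose M P Q -> forall P' Q', choose M P' Q' ->
  (P = P' /\ Q = Q') \/
  exists a b c d, choose P a b /\ choose Q c d /\ choose P' a c /\ choose Q' b d.
Proof.
  induction 1 as [P Q | M P Q A H IH | M P Q A H IH]; intros P' Q' HC;
    inversion HC; subst; auto.
  2, 3: right; do 4 eexists; repeat split; constructor; eassumption.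
  all: match goal with H : choose _ _ _ |- _ =>
         destruct (IH _ _ H) as [[-> ->]|(a & b & c & d & Ha & Hb & Hc & Hd)];
         [auto|right; do 4 eexists; repeat split; constructor; eassumption] end.
Qed.

(** * Invariants of unbiased steps from weakly normal terms *)

Lemma wnormal_appl P Q : wnormal (App P Q) -> wnormal P.
Proof.
  rewrite !wnormal_iff. intros H M' HM. apply (H (App M' Q)). constructor; exact HM.
Qed.

Lemma wnormal_appr P Q : wnormal (App P Q) -> wnormal Q.
Proof.
  rewrite !wnormal_iff. intros H M' HM. apply (H (App P M')). constructor; exact HM.
Qed.

Lemma wnormal_not_wstep M M' : wnormal M -> ~ wstep M M'.
Proof. intros H HM. apply H. eauto. Qed.

(** From a weakly normal term an unbiased step acts strictly below the root, so the head constructor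
    is preserved. *)
Lemma ustep_to_lam M P : wnormal M -> ustep M (Lam P) -> exists P', M = Lam P'.
Proof.
  intros Hn H. inversion H; subst; eauto.
  exfalso; eapply wnormal_not_wstep; eauto.
Qed.

Lemma ustep_value M M' : wnormal M -> ustep M M' -> is_value M <-> is_value M'.
Proof.
  intros Hn H. inversion H; subst; simpl; try tauto.
  exfalso; eapply wnormal_not_wstep; eauto.
Qed.

Lemma wnormal_app P Q : wnormal P -> wnormal Q ->
  ~ (is_value Q /\ exists R, P = Lam R) -> wnormal (App P Q).
Proof.
  rewrite !wnormal_iff. intros HP HQ H M' HM. inversion HM; subst; eauto.
  eapply HP; eauto. eapply HQ; eauto.
Qed.

Lemma wnormal_app_inv P Q : wnormal (App P Q) ->
  ~ (is_value Q /\ exists R, P = Lam R).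
Proof.
  rewrite wnormal_iff. intros H [HQ (R & ->)]. eapply H. constructor. exact HQ.
Qed.

Lemma wnormal_lam P : wnormal (Lam P).
Proof. rewrite wnormal_iff. intros M' H. inversion H. Qed.

Lemma wnormal_choice P Q : wnormal (Choice P Q).
Proof. rewrite wnormal_iff. intros M' H. inversion H. Qed.

(** A new weak redex would require the function to become an abstraction or the argument to become a
    value, which steps below the root cannot achieve. *)
Lemma ustep_wnormal M M' : ustep M M' -> wnormal M -> wnormal M'.
Proof.
  induction 1 as [M M' H | P P' Hn H IH | P P' Q Hn H IH | P Q Q' Hn H IH
                 | P P' Q Hn H IH | P Q Q' Hn H IH]; intros HM.
  - destruct (wnormal_not_wstep _ _ HM H).
  - apply wnormal_lam.
  - assert (HP := wnormal_appl _ _ Hn).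
    apply wnormal_app; [auto|exact (wnormal_appr _ _ Hn)|].
    intros [HQ (R & ->)]. apply (wnormal_app_inv _ _ Hn).
    eauto using ustep_to_lam.
  - assert (HQ := wnormal_appr _ _ Hn).
    apply wnormal_app; [exact (wnormal_appl _ _ Hn)|auto|].
    intros [HQ' HR]. apply (wnormal_app_inv _ _ Hn).
    split; [apply (ustep_value _ _ HQ H), HQ'|exact HR].
  - apply wnormal_choice.
  - apply wnormal_choice.
Qed.

(** Such a step keeps every node on a weak path, choice nodes included, so surface choices are
    neither created nor removed. *)
Lemma ustep_choose M M' : ustep M M' -> wnormal M ->
  (exists P Q, choose M P Q) <-> (exists P Q, choose M' P Q).
Proof.
  induction 1 as [M M' H | P P' Hn H IH | P P' Q Hn H IH | P Q Q' Hn H IH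
                 | P P' Q Hn H IH | P Q Q' Hn H IH]; intros HM.
  - destruct (wnormal_not_wstep _ _ HM H).
  - split; intros (A & B & HC); inversion HC.
  - specialize (IH (wnormal_appl _ _ Hn)).
    split; intros (A & B & HC); inversion HC; subst; eauto using choose.
    + destruct (proj1 IH) as (? & ? & ?); eauto using choose.
    + destruct (proj2 IH) as (? & ? & ?); eauto using choose.
  - specialize (IH (wnormal_appr _ _ Hn)).
    split; intros (A & B & HC); inversion HC; subst; eauto using choose.
    + destruct (proj1 IH) as (? & ? & ?); eauto using choose.
    + destruct (proj2 IH) as (? & ? & ?); eauto using choose.
  - split; eauto using choose.
  - split; eauto using choose.
Qed.

Lemma snormal_iff_wnormal M :
  snormal M <-> wnormal M /\ ~ exists P Q, choose M P Q.
Proof.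
  rewrite snormal_iff, wnormal_iff. split; intros [H1 H2]; split; auto.
  - intros (P & Q & H). exact (H2 _ _ H).
  - intros P Q H. eauto.
Qed.

(** The forward direction keeps E-reduction in its unbiased phase; the converse lets a reduction
    with a surface-normal target be read as E-steps from its start. *)
Lemma ustep_snormal M M' : wnormal M -> ustep M M' -> snormal M <-> snormal M'.
Proof.
  intros Hn H. rewrite !snormal_iff_wnormal, (ustep_choose _ _ H Hn).
  pose proof (ustep_wnormal _ _ H Hn). tauto.
Qed.

(** Weak normality persists, so the side condition of each congruence rule still holds after the
    competing step, and steps in different subterms commute. *)
Lemma ustep_diamond M A : ustep M A -> forall B, ustep M B ->
  A = B \/ exists D, ustep A D /\ ustep B D.
Proof.
  induction 1 as [M M' H | P P' Hn H IH | P P' Q Hn H IH | P Q Q' Hn H IH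
                 | P P' Q Hn H IH | P Q Q' Hn H IH]; intros B HB.
  1: { inversion HB; subst;
       try match goal with Hw : wnormal ?X, HX : wstep ?X _ |- _ =>
      destruct (wnormal_not_wstep _ _ Hw HX) end.
       apply wstep_iff in H. match goal with HW : wstep _ B |- _ => apply wstep_iff in HW;
         destruct (wbeta_diamond _ _ H _ HW) as [->|(D & Ha & Hb)] end;
       [auto|right; exists D; split; apply U_w, wstep_iff; assumption]. }
  all: assert (Hn' := ustep_wnormal _ _ HB Hn).
  all: inversion HB; subst;
    try match goal with Hw : wnormal ?X, HX : wstep ?X _ |- _ =>
      destruct (wnormal_not_wstep _ _ Hw HX) end.
  all: try match goal with
    | IH : forall B, ustep ?P B -> _, HC : ustep ?P _ |- _ =>
      destruct (IH _ HC) as [->|(D & Ha & Hb)]; [left; reflexivity|] end.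
  all: right; eexists; split;
    first [ apply U_lam; [|eassumption] | apply U_appl; [|eassumption]
          | apply U_appr; [|eassumption] | apply U_chl; [|eassumption]
          | apply U_chr; [|eassumption] ];
    try apply wnormal_lam; try apply wnormal_choice; try assumption.
  all: eapply ustep_wnormal; [|exact Hn]; eauto using ustep.
Qed.

(** * Reaching a normal form with a given probability *)

(* The probability [r] only accounts for some of the branches: any subtree may
   be cut off with the value 0. *)
Inductive reach (one : term -> term -> Prop) (N : term) : nat -> term -> R -> Prop :=
| reach_zero n M : reach one N n M 0
| reach_refl n : reach one N n N 1
| reach_one n M M' r : one M M' -> reach one N n M' r -> reach one N (S n) M r
| reach_choose n M P Q a b : choose M P Q ->
    reach one N n P a -> reach one N n Q b -> reach one N (S n) M ((a + b) / 2).

Lemma reach_le one N n M r : reach one N n M r ->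
  forall k, (n <= k)%nat -> reach one N k M r.
Proof.
  induction 1 as [n M | n | n M M' r H1 H IH | n M P Q a b H1 Ha IHa Hb IHb];
    intros k Hk; try (constructor; fail);
    destruct k as [|k]; try lia.
  - eapply reach_one; [exact H1|]. apply IH. lia.
  - eapply reach_choose; [exact H1| |]; [apply IHa|apply IHb]; lia.
Qed.

Lemma reach_clos one N M M' : clos_refl_trans_1n _ one M M' ->
  forall n r, reach one N n M' r -> exists k, reach one N k M r.
Proof.
  induction 1 as [M|M M1 M' H1 H IH]; intros n r Hr; [eauto|].
  destruct (IH _ _ Hr) as (k & Hk). exists (S k). eapply reach_one; eauto.
Qed.

Lemma reach_O_nonnormal one N M r :
  Nnf N -> ~ Nnf M -> reach one N 0 M r -> r = 0.
Proof. intros HN HM H. inversion H; subst; [reflexivity|contradiction]. Qed.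

Lemma beta_not_Nnf M M' : beta M M' -> ~ Nnf M.
Proof. intros H Hn. apply Nnf_iff in Hn as [Hn _]. exact (Hn _ H). Qed.

Lemma choose_not_Nnf M P Q : choose M P Q -> ~ Nnf M.
Proof. intros H Hn. apply Nnf_iff in Hn as [_ Hn]. exact (Hn _ _ H). Qed.

Lemma wbeta_not_snormal M M' : wbeta M M' -> ~ snormal M.
Proof. intros H Hn. apply snormal_iff in Hn as [Hn _]. exact (Hn _ H). Qed.

Lemma choose_not_snormal M P Q : choose M P Q -> ~ snormal M.
Proof. intros H Hn. apply snormal_iff in Hn as [_ Hn]. exact (Hn _ _ H). Qed.

(** Weak and unbiased steps never compete, as the former exclude surface normality; each phase has
    its own diamond. *)
Lemma ebeta_diamond M A B : ebeta M A -> ebeta M B ->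
  A = B \/ exists D, ebeta A D /\ ebeta B D.
Proof.
  intros [HA|[Hn HA]] [HB|[Hn' HB]].
  - destruct (wbeta_diamond _ _ HA _ HB) as [->|(D & H1 & H2)]; [auto|].
    right. exists D. unfold ebeta. auto.
  - destruct (wbeta_not_snormal _ _ HA Hn').
  - destruct (wbeta_not_snormal _ _ HB Hn).
  - assert (Hw : wnormal M) by (apply snormal_iff_wnormal, Hn).
    destruct (ustep_diamond _ _ HA _ HB) as [->|(D & H1 & H2)]; [auto|].
    right. exists D.
    split; right; (split; [apply (ustep_snormal M); assumption|assumption]).
Qed.

Lemma ebeta_choose_diamond M A P Q : ebeta M A -> choose M P Q ->
  exists P' Q', choose A P' Q' /\ ebeta P P' /\ ebeta Q Q'.
Proof.
  intros [H|[Hn _]] HC; [|destruct (choose_not_snormal _ _ _ HC Hn)].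
  destruct (wbeta_choose_diamond _ _ H _ _ HC) as (P' & Q' & H1 & H2 & H3).
  exists P', Q'. unfold ebeta. auto.
Qed.

(* Random descent: whatever E-step is taken, it shortens every E-evaluation. *)
Lemma reach_ebeta_descent N (HN : Nnf N) n : forall M r, reach ebeta N (S n) M r ->
  (forall M', ebeta M M' -> reach ebeta N n M' r) /\
  (forall P Q, choose M P Q ->
     exists a b, reach ebeta N n P a /\ reach ebeta N n Q b /\ r = (a + b) / 2).
Proof.
  induction n as [|n IH]; intros M r H;
    (inversion H as [? ?|?|? ? M1 ? H1 HM1|? ? P1 Q1 a b H1 HP1 HQ1]; subst;
     [ split; [intros; constructor|];
       intros; exists 0, 0; repeat split; try constructor; lra
     | split; [intros M' HM'; destruct (beta_not_Nnf _ _ (ebeta_beta _ _ HM') HN)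
              |intros P Q HC; destruct (choose_not_Nnf _ _ _ HC HN)]
     | .. ]).
  (* With depth one, the subtree left after the step has depth 0. If diverging steps must still be
     joined, its root is not normal, hence differs from [N], and its value is 0. *)
  - split.
    + intros M' HM'. destruct (ebeta_diamond _ _ _ H1 HM') as [->|(D & HA & HB)]; [auto|].
      apply reach_O_nonnormal in HM1; [subst; constructor|exact HN|].
      eapply beta_not_Nnf, ebeta_beta, HA.
    + intros P Q HC. destruct (ebeta_choose_diamond _ _ _ _ H1 HC) as (P' & Q' & HA & _).
      apply reach_O_nonnormal in HM1; [subst|exact HN|exact (choose_not_Nnf _ _ _ HA)].
      exists 0, 0. repeat split; try constructor. lra.
  - split.
    + intros M' HM'. destruct (ebeta_choose_diamond _ _ _ _ HM' H1) as (P' & Q' & _ & HP & HQ).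
      apply reach_O_nonnormal in HP1, HQ1; try exact HN;
        try (eapply beta_not_Nnf, ebeta_beta; eassumption).
      subst. replace ((0 + 0) / 2) with 0 by lra. constructor.
    + intros P Q HC. destruct (choose_diamond _ _ _ H1 _ _ HC)
        as [[-> ->]|(u & v & w & z & Hu & Hw & _ & _)]; [eauto|].
      apply reach_O_nonnormal in HP1, HQ1; try exact HN;
        try (eapply choose_not_Nnf; eassumption).
      subst. exists 0, 0. repeat split; constructor.
  - split.
    + intros M' HM'. destruct (ebeta_diamond _ _ _ H1 HM') as [->|(D & HA & HB)]; [auto|].
      eapply reach_one; [exact HB|]. apply (IH _ _ HM1), HA.
    + intros P Q HC.
      destruct (ebeta_choose_diamond _ _ _ _ H1 HC) as (P' & Q' & HA & HP & HQ).
      destruct (proj2 (IH _ _ HM1) _ _ HA) as (a & b & Ha & Hb & ->).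
      exists a, b. repeat split; eapply reach_one; eassumption.
  - split.
    + intros M' HM'.
      destruct (ebeta_choose_diamond _ _ _ _ HM' H1) as (P' & Q' & HA & HP & HQ).
      eapply reach_choose; [exact HA| |];
        [apply (IH _ _ HP1), HP|apply (IH _ _ HQ1), HQ].
    + intros P Q HC. destruct (choose_diamond _ _ _ H1 _ _ HC)
        as [[-> ->]|(u & v & w & z & Hu & Hv & Hw & Hz)]; [eauto|].
      destruct (proj2 (IH _ _ HP1) _ _ Hu) as (au & av & Hau & Hav & ->).
      destruct (proj2 (IH _ _ HQ1) _ _ Hv) as (aw & az & Haw & Haz & ->).
      (* The four quarter-weighted outcomes are regrouped by the columns of the table instead of its
         rows. *)
      exists ((au + aw) / 2), ((av + az) / 2).
      split; [eapply reach_choose; eassumption|].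
      split; [eapply reach_choose; eassumption|lra].
Qed.

(** * Standardization *)

Definition wbetas : term -> term -> Prop := clos_refl_trans_1n _ wbeta.

Lemma wbetas_trans A B C : wbetas A B -> wbetas B C -> wbetas A C.
Proof.
  unfold wbetas. rewrite <- !clos_rt_rt1n_iff. apply rt_trans.
Qed.

Lemma wbetas_map (f : term -> term) :
  (forall A B, wbeta A B -> wbeta (f A) (f B)) ->
  forall A B, wbetas A B -> wbetas (f A) (f B).
Proof.
  intros Hf A B. induction 1 as [A|A B C HAB H IH]; [constructor|].
  eapply Relation_Operators.rt1n_trans; [apply Hf, HAB|exact IH].
Qed.

Lemma wbetas_app P P' Q Q' : wbetas P P' -> wbetas Q Q' ->
  wbetas (App P Q) (App P' Q').
Proof.
  intros HP HQ. apply wbetas_trans with (App P' Q).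
  - apply (wbetas_map (fun X => App X Q)); [constructor; assumption|exact HP].
  - apply (wbetas_map (App P')); [constructor; assumption|exact HQ].
Qed.

Lemma wbeta_shift d c M M' : wbeta M M' -> wbeta (shift d c M) (shift d c M').
Proof.
  induction 1 as [P V HV | P P' Q H IH | P Q Q' H IH]; simpl; try (constructor; assumption).
  unfold subst0. assert (HS := shift_substk P V d 0 c). cbn [Nat.add] in HS. rewrite HS.
  apply wbeta_root, is_value_shift, HV.
Qed.

(** [V] must be a value: a redex whose argument is the replaced variable survives only if its new
    argument is a value. *)
Lemma wbeta_substk k V M M' : is_value V -> wbeta M M' ->
  wbeta (substk k V M) (substk k V M').
Proof.
  intros HV. induction 1 as [P U HU | P P' Q H IH | P Q Q' H IH]; simpl;
    try (constructor; assumption).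
  unfold subst0. assert (HS := substk_substk P U V 0 k). cbn [Nat.add] in HS. rewrite HS.
  apply wbeta_root, is_value_substk; assumption.
Qed.

(* A beta-reduction from [M] to [M'] in standard form: weak steps first, then
   recursively inside the immediate subterms. *)
Inductive std : term -> term -> Prop :=
| std_var M n : wbetas M (Var n) -> std M (Var n)
| std_lam M P P' : wbetas M (Lam P) -> std P P' -> std M (Lam P')
| std_app M P Q P' Q' : wbetas M (App P Q) -> std P P' -> std Q Q' -> std M (App P' Q')
| std_choice M P Q P' Q' : wbetas M (Choice P Q) -> std P P' -> std Q Q' ->
    std M (Choice P' Q').

Lemma std_refl M : std M M.
Proof.
  induction M; [eapply std_var|eapply std_lam|eapply std_app|eapply std_choice];
    eauto; constructor.
Qed.

Lemma std_wbetas A M M' : wbetas A M -> std M M' -> std A M'.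
Proof.
  intros HA H. destruct H; [eapply std_var|eapply std_lam|eapply std_app|eapply std_choice];
    eauto using wbetas_trans.
Qed.

Lemma std_shift M M' : std M M' -> forall d c, std (shift d c M) (shift d c M').
Proof.
  induction 1 as [M n HM | M P P' HM HP IHP | M P Q P' Q' HM HP IHP HQ IHQ
                 | M P Q P' Q' HM HP IHP HQ IHQ]; intros d c;
    apply (wbetas_map (shift d c)) in HM; try (apply wbeta_shift; assumption).
  - eapply std_wbetas; [exact HM|apply std_refl].
  - eapply std_lam; [exact HM|apply IHP].
  - eapply std_app; [exact HM|apply IHP|apply IHQ].
  - eapply std_choice; [exact HM|apply IHP|apply IHQ].
Qed.

(** The source [V] is required to be a value because the weak steps that start the reduction of [M]
    are replayed under the substitution. *)
Lemma std_substk M M' V V' : std M M' -> is_value V -> std V V' ->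
  forall k, std (substk k V M) (substk k V' M').
Proof.
  intros H HV HVV'.
  induction H as [M n HM | M P P' HM HP IHP | M P Q P' Q' HM HP IHP HQ IHQ
                 | M P Q P' Q' HM HP IHP HQ IHQ]; intros k;
    apply (wbetas_map (substk k V)) in HM;
    try (intros; apply wbeta_substk; assumption).
  - eapply std_wbetas; [exact HM|]. simpl.
    nat_cases; auto using std_refl, std_shift.
  - eapply std_lam; [exact HM|apply IHP].
  - eapply std_app; [exact HM|apply IHP|apply IHQ].
  - eapply std_choice; [exact HM|apply IHP|apply IHQ].
Qed.

Lemma std_value M V' : std M V' -> is_value V' ->
  exists V, wbetas M V /\ is_value V /\ std V V'.
Proof.
  intros H HV. destruct H as [M n HM | M P P' HM HP | |]; try contradiction.
  - exists (Var n). repeat split; [exact HM|apply std_refl].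
  - exists (Lam P). repeat split; [exact HM|].
    eapply std_lam; [constructor|exact HP].
Qed.

(** Steps below the root are absorbed recursively. A root redex is exposed in [M] by weak steps,
    contracted weakly, and the remaining reductions pass through the substitution. *)
Lemma std_beta M' M'' : beta M' M'' -> forall M, std M M' -> std M M''.
Proof.
  induction 1 as [P V HV | P P' H IH | P P' Q H IH | P Q Q' H IH
                 | P P' Q H IH | P Q Q' H IH]; intros M HM;
    inversion HM as [|? A ? HA HP|? A B ? ? HA HP HQ|? A B ? ? HA HP HQ]; subst.
  - inversion HP as [|? A' ? HA' HP'| |]; subst.
    (* The argument of [M] is first brought by weak steps to a value [U], so that the exposed redex
       may fire. *)
    destruct (std_value _ _ HQ HV) as (U & HBU & HU & HUV).
    apply std_wbetas with (subst0 U A').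
    + eapply wbetas_trans; [exact HA|].
      eapply wbetas_trans; [apply wbetas_app; eassumption|].
      eapply Relation_Operators.rt1n_trans; [apply wbeta_root, HU|constructor].
    + apply std_substk; assumption.
  - eapply std_lam; eauto.
  - eapply std_app; eauto.
  - eapply std_app; eauto.
  - eapply std_choice; eauto.
  - eapply std_choice; eauto.
Qed.

(** A surface choice lies on a weak path, so weak steps alone expose it; the postponed reductions
    are then inherited by both branches. *)
Lemma std_choose M' P' Q' : choose M' P' Q' -> forall M, std M M' ->
  exists M1 P Q, wbetas M M1 /\ choose M1 P Q /\ std P P' /\ std Q Q'.
Proof.
  induction 1 as [P Q | M' P Q A H IH | M' P Q A H IH]; intros M HM;
    inversion HM as [|? B ? HB HP|? B C ? ? HB HP HQ|? B C ? ? HB HP HQ]; subst.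
  - exists (Choice B C), B, C. repeat split; auto. constructor.
  - destruct (IH _ HP) as (M1 & P1 & Q1 & H1 & H2 & H3 & H4).
    exists (App M1 C), (App P1 C), (App Q1 C).
    split; [eapply wbetas_trans; [exact HB|apply wbetas_app; [exact H1|constructor]]|].
    split; [constructor; exact H2|].
    split; (eapply std_app; [constructor|assumption|assumption]).
  - destruct (IH _ HQ) as (M1 & P1 & Q1 & H1 & H2 & H3 & H4).
    exists (App B M1), (App B P1), (App B Q1).
    split; [eapply wbetas_trans; [exact HB|apply wbetas_app; [constructor|exact H1]]|].
    split; [constructor; exact H2|].
    split; (eapply std_app; [constructor|assumption|assumption]).
Qed.

(** * From standard reductions to E-reductions *)

Definition inner (M M' : term) : Prop := wnormal M /\ ustep M M'.

Definition inners : term -> term -> Prop := clos_refl_trans_1n _ inner.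

Lemma inners_wnormal M M' : inners M M' -> wnormal M -> wnormal M'.
Proof.
  induction 1 as [|M M1 M' [_ H1] H IH]; auto. intros HM.
  apply IH, (ustep_wnormal _ _ H1 HM).
Qed.

Lemma inners_snormal M M' : inners M M' -> snormal M <-> snormal M'.
Proof.
  induction 1 as [|M M1 M' [Hn H1] H IH]; [reflexivity|].
  rewrite <- IH. apply ustep_snormal; assumption.
Qed.

Lemma inners_value M M' : inners M M' -> is_value M <-> is_value M'.
Proof.
  induction 1 as [|M M1 M' [Hn H1] H IH]; [reflexivity|].
  rewrite <- IH. apply ustep_value; assumption.
Qed.

Lemma inners_lam P N : inners (Lam P) N -> exists P', N = Lam P'.
Proof.
  intros H. remember (Lam P) as L eqn:HL. revert P HL.
  induction H as [|A B C [Hn H1] H IH]; intros P ->; [eauto|].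
  inversion H1; subst; [|eauto].
  exfalso; eapply wnormal_not_wstep; eassumption.
Qed.

Lemma inners_usteps M M' : inners M M' -> clos_refl_trans_1n _ ustep M M'.
Proof.
  induction 1 as [|M M1 M' [_ H1] H IH]; [constructor|].
  eapply Relation_Operators.rt1n_trans; eassumption.
Qed.

Lemma wbetas_usteps M M' : wbetas M M' -> clos_refl_trans_1n _ ustep M M'.
Proof.
  induction 1 as [|M M1 M' H1 H IH]; [constructor|].
  eapply Relation_Operators.rt1n_trans; [apply U_w, wstep_iff, H1|exact IH].
Qed.

(** Once the enclosing term is weakly normal, all unbiased steps of a subterm, its weak ones
    included, become inner steps of the whole. *)
Lemma inners_map (f : term -> term) :
  (forall A B, ustep A B -> wnormal (f A) -> ustep (f A) (f B)) ->
  forall A B, clos_refl_trans_1n _ ustep A B -> wnormal (f A) -> inners (f A) (f B).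
Proof.
  intros Hf A B. induction 1 as [A|A B C HAB H IH]; intros HA; [constructor|].
  eapply Relation_Operators.rt1n_trans; [split; [exact HA|apply Hf, HA; exact HAB]|].
  apply IH. eapply ustep_wnormal; [apply Hf, HA; exact HAB|exact HA].
Qed.

Definition unbiased_eval (M N : term) : Prop :=
  exists M1, wbetas M M1 /\ wnormal M1 /\ inners M1 N.

Lemma unbiased_eval_usteps M N :
  unbiased_eval M N -> clos_refl_trans_1n _ ustep M N.
Proof.
  intros (M1 & H1 & _ & H2). apply clos_rt_rt1n_iff.
  eapply rt_trans; apply clos_rt_rt1n_iff;
    [apply wbetas_usteps, H1|apply inners_usteps, H2].
Qed.

(** The weak phases of the subterms of an application are merged into one; beta-normality of [N]
    guarantees that the merged phase ends in a weakly normal term. *)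
Lemma std_unbiased_eval M N : std M N -> (forall N', ~ beta N N') -> unbiased_eval M N.
Proof.
  induction 1 as [M n HM | M P P' HM HP IHP | M P Q P' Q' HM HP IHP HQ IHQ
                 | M P Q P' Q' HM HP IHP HQ IHQ]; intros HN.
  - exists (Var n). split; [exact HM|]. split; [|constructor].
    apply wnormal_iff. intros M' H. inversion H.
  - exists (Lam P). split; [exact HM|]. split; [apply wnormal_lam|].
    apply (inners_map Lam); [intros; constructor; assumption| |apply wnormal_lam].
    apply unbiased_eval_usteps, IHP. intros X HX. apply (HN (Lam X)). constructor; exact HX.
  - destruct IHP as (P1 & HP1 & HnP & HP2);
      [intros X HX; apply (HN (App X Q')); constructor; exact HX|].
    destruct IHQ as (Q1 & HQ1 & HnQ & HQ2);
      [intros X HX; apply (HN (App P' X)); constructor; exact HX|].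
    assert (Hn : wnormal (App P1 Q1)).
    (* Inner steps preserve values and abstractions, so a root redex here would persist in the
       target. *)
    { apply wnormal_app; [exact HnP|exact HnQ|]. intros [HV (R & ->)].
      apply (inners_value _ _ HQ2) in HV.
      destruct (inners_lam _ _ HP2) as (R' & ->).
      eapply HN. constructor. exact HV. }
    exists (App P1 Q1).
    split; [eapply wbetas_trans; [exact HM|apply wbetas_app; assumption]|].
    split; [exact Hn|].
    apply clos_rt_rt1n_iff. apply rt_trans with (App P' Q1);
      apply clos_rt_rt1n_iff.
    + apply (inners_map (fun X => App X Q1)); [intros; constructor; assumption| |exact Hn].
      apply inners_usteps, HP2.
    + apply (inners_map (App P')); [intros; constructor; assumption| |].
      * apply inners_usteps, HQ2.
      * eapply inners_wnormal; [|exact Hn].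
        apply (inners_map (fun X => App X Q1)); [intros; constructor; assumption| |exact Hn].
        apply inners_usteps, HP2.
  - exists (Choice P Q). split; [exact HM|]. split; [apply wnormal_choice|].
    apply clos_rt_rt1n_iff. apply rt_trans with (Choice P' Q);
      apply clos_rt_rt1n_iff.
    + apply (inners_map (fun X => Choice X Q));
        [intros; constructor; assumption| |apply wnormal_choice].
      apply unbiased_eval_usteps, IHP. intros X HX.
      apply (HN (Choice X Q')). constructor; exact HX.
    + apply (inners_map (Choice P'));
        [intros; constructor; assumption| |apply wnormal_choice].
      apply unbiased_eval_usteps, IHQ. intros X HX.
      apply (HN (Choice P' X)). constructor; exact HX.
Qed.

Lemma wbetas_ebetas M M' : wbetas M M' -> clos_refl_trans_1n _ ebeta M M'.
Proof.
  induction 1 as [|M M1 M' H1 H IH]; [constructor|].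
  eapply Relation_Operators.rt1n_trans; [left; exact H1|exact IH].
Qed.

Lemma inners_ebetas M M' : inners M M' -> snormal M' ->
  clos_refl_trans_1n _ ebeta M M'.
Proof.
  induction 1 as [|M M1 M' [Hn H1] H IH]; intros HM; [constructor|].
  eapply Relation_Operators.rt1n_trans; [right|exact (IH HM)].
  split; [|exact H1].
  apply (ustep_snormal _ _ Hn H1), (inners_snormal _ _ H), HM.
Qed.

Lemma Nnf_snormal N : Nnf N -> snormal N.
Proof.
  rewrite Nnf_iff, snormal_iff. intros [H1 H2]; split; [|exact H2].
  intros M' H. apply (H1 M'), wbeta_beta, H.
Qed.

(** Induction on the evaluation tree: beta-steps are absorbed into [std], choices are exposed by
    weak steps, and at a leaf [N] the accumulated [std] unfolds into E-steps. The depth may change,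
    hence the new bound [k]. *)
Lemma std_reach N n M' r : Nnf N -> reach beta N n M' r ->
  forall M, std M M' -> exists k, reach ebeta N k M r.
Proof.
  intros HN.
  induction 1 as [n M' | n | n M' M'' r H1 H IH | n M' P Q a b H1 Ha IHa Hb IHb];
    intros M HM.
  - exists 0%nat. constructor.
  - destruct (std_unbiased_eval _ _ HM) as (M1 & H1 & _ & H2);
      [apply Nnf_iff, HN|].
    apply reach_clos with (n := 0%nat) (M' := N); [|constructor].
    apply clos_rt_rt1n_iff. apply rt_trans with M1; apply clos_rt_rt1n_iff;
      [apply wbetas_ebetas, H1|apply inners_ebetas, Nnf_snormal; assumption].
  - apply IH. eapply std_beta; eassumption.
  - destruct (std_choose _ _ _ H1 _ HM) as (M1 & P1 & Q1 & HM1 & HC & HP & HQ).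
    destruct (IHa _ HP) as (ka & Hka). destruct (IHb _ HQ) as (kb & Hkb).
    eapply reach_clos; [apply wbetas_ebetas, HM1|].
    eapply reach_choose with (n := Nat.max ka kb); [exact HC| |];
      eapply reach_le; eauto; lia.
Qed.

(** * Multi-distributions *)

(** A relational expectation: each entry picks its own value among those [X] allows, since [reach]
    relates a term to several probabilities. *)
Inductive wsum (X : term -> R -> Prop) : mdist -> R -> Prop :=
| wsum_nil : wsum X [] 0
| wsum_cons p M r m v : X M r -> wsum X m v -> wsum X ((p, M) :: m) (p * r + v).

Lemma wsum_impl (X Y : term -> R -> Prop) m v :
  (forall M r, X M r -> Y M r) -> wsum X m v -> wsum Y m v.
Proof. intros H. induction 1; constructor; auto. Qed.

Lemma wsum_app X m1 m2 v1 v2 : wsum X m1 v1 -> wsum X m2 v2 ->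
  wsum X (m1 ++ m2) (v1 + v2).
Proof.
  intros H H2. induction H as [|p M r m v HM H IH]; simpl.
  - rewrite Rplus_0_l; exact H2.
  - rewrite Rplus_assoc. constructor; assumption.
Qed.

Lemma wsum_app_inv X m1 m2 v : wsum X (m1 ++ m2) v ->
  exists v1 v2, wsum X m1 v1 /\ wsum X m2 v2 /\ v = v1 + v2.
Proof.
  revert v. induction m1 as [|[p M] m1 IH]; simpl; intros v H.
  - exists 0, v. repeat split; [constructor|exact H|lra].
  - inversion H as [|? ? r ? w HM Hw]; subst.
    destruct (IH _ Hw) as (v1 & v2 & H1 & H2 & ->).
    exists (p * r + v1), v2. repeat split; [constructor; assumption|exact H2|lra].
Qed.

Lemma wsum_scale X p m v : wsum X m v -> wsum X (scale p m) (p * v).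
Proof.
  induction 1 as [|q M r m v HM H IH]; simpl.
  - rewrite Rmult_0_r. constructor.
  - replace (p * (q * r + v)) with (p * q * r + p * v) by lra.
    constructor; assumption.
Qed.

Lemma wsum_scale_inv X p m v : wsum X (scale p m) v ->
  exists w, wsum X m w /\ v = p * w.
Proof.
  revert v. induction m as [|[q M] m IH]; simpl; intros v H.
  - inversion H; subst. exists 0. split; [constructor|lra].
  - inversion H as [|? ? r ? w HM Hw]; subst.
    destruct (IH _ Hw) as (w' & Hw' & ->).
    exists (q * r + w'). split; [constructor; assumption|lra].
Qed.

Lemma wsum_perm X m m' : Permutation m m' -> forall v, wsum X m v -> wsum X m' v.
Proof.
  induction 1 as [|[p M] m m' H IH|[p M] [q Q] m|m1 m2 m3 H1 IH1 H2 IH2];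
    intros v Hv; auto.
  - inversion Hv; subst. constructor; auto.
  - inversion Hv as [|? ? r ? w HM Hw]; subst.
    inversion Hw as [|? ? r' ? w' HM' Hw']; subst.
    replace (q * r + (p * r' + w')) with (p * r' + (q * r + w')) by lra.
    repeat constructor; assumption.
Qed.

Lemma wsum_dirac X M r : X M r -> wsum X (dirac M) r.
Proof.
  intros H. replace r with (1 * r + 0) by lra. repeat constructor. exact H.
Qed.

Lemma wsum_dirac_inv X M r : wsum X (dirac M) r -> X M r.
Proof.
  intros H. inversion H as [|? ? r' ? w HM Hw]; subst. inversion Hw; subst.
  replace (1 * r' + 0) with r' by lra. exact HM.
Qed.

Lemma wsum_half X P Q a b : X P a -> X Q b ->
  wsum X [(1/2, P); (1/2, Q)] ((a + b) / 2).
Proof.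
  intros HP HQ. replace ((a + b) / 2) with (1/2 * a + (1/2 * b + 0)) by lra.
  repeat constructor; assumption.
Qed.

Lemma wsum_half_inv X P Q v : wsum X [(1/2, P); (1/2, Q)] v ->
  exists a b, X P a /\ X Q b /\ v = (a + b) / 2.
Proof.
  intros H. inversion H as [|? ? a ? w HP Hw]; subst.
  inversion Hw as [|? ? b ? w' HQ Hw']; subst. inversion Hw'; subst.
  exists a, b. repeat split; [exact HP|exact HQ|lra].
Qed.

(** Reduces transport along a lifted step, here backwards, to a single entry; linearity of [wsum]
    and its invariance under permutation do the rest. *)
Lemma lift_gen_pull (X Y : term -> R -> Prop) full r m m' v :
  (forall M mi w, lift_one full r M mi -> wsum X mi w -> Y M w) ->
  lift_gen full r m m' -> wsum X m' v -> wsum Y m v.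
Proof.
  intros HXY (ms & Hms & Hp) Hv. apply (wsum_perm _ _ _ Hp) in Hv. clear Hp.
  revert v Hv. induction Hms as [|[p M] mi m ms HM Hms IH]; simpl; intros v Hv.
  - inversion Hv; subst; constructor.
  - apply wsum_app_inv in Hv as (v1 & v2 & H1 & H2 & ->).
    apply wsum_scale_inv in H1 as (w & Hw & ->).
    constructor; eauto.
Qed.

Lemma lift_gen_push (X Y : term -> R -> Prop) full r m m' v :
  (forall M mi w, lift_one full r M mi -> X M w -> wsum Y mi w) ->
  lift_gen full r m m' -> wsum X m v -> wsum Y m' v.
Proof.
  intros HXY (ms & Hms & Hp) Hv. apply Permutation_sym in Hp.
  apply (wsum_perm _ _ _ Hp). clear Hp.
  revert v Hv. induction Hms as [|[p M] mi m ms HM Hms IH]; simpl; intros v Hv.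
  - inversion Hv; subst; constructor.
  - inversion Hv as [|? ? w ? v' HMw Hv']; subst.
    apply wsum_app; [apply wsum_scale; eauto|auto].
Qed.

(** * Transport of reaching probabilities along lifted steps *)

Definition reachable one N M r := exists n, reach one N n M r.

Lemma Step_pull N m m' v : Step m m' ->
  wsum (reachable beta N) m' v -> wsum (reachable beta N) m v.
Proof.
  apply lift_gen_pull. intros M mi w [[-> _]|H] Hw.
  - apply wsum_dirac_inv, Hw.
  - apply step_iff in H as [(M' & H & ->)|(P & Q & H & ->)].
    + apply wsum_dirac_inv in Hw as (n & Hn). exists (S n).
      eapply reach_one; eassumption.
    + apply wsum_half_inv in Hw as (a & b & (n & Ha) & (k & Hb) & ->).
      exists (S (Nat.max n k)).
      eapply reach_choose; [exact H| |]; eapply reach_le; eauto; lia.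
Qed.

(** Fullness of the lifting is essential: an entry may stay put only when normal, where its tree has
    no step to spend, so one unit of depth is consumed uniformly. *)
Lemma EStep_push N n m m' v : Nnf N -> EStep m m' ->
  wsum (reach ebeta N (S n)) m v -> wsum (reach ebeta N n) m' v.
Proof.
  intros HN. apply lift_gen_push. intros M mi w [[-> HM]|H] Hw.
  - apply wsum_dirac. specialize (HM eq_refl).
    inversion Hw as [| |? ? M' ? H1|? ? P Q a b H1]; subst; try constructor.
    + destruct (beta_not_Nnf _ _ (ebeta_beta _ _ H1) HM).
    + destruct (choose_not_Nnf _ _ _ H1 HM).
  - apply (reach_ebeta_descent N HN) in Hw as [H1 H2].
    apply estep_iff in H as [(M' & H & ->)|(P & Q & H & ->)].
    + apply wsum_dirac; auto.
    + destruct (H2 _ _ H) as (a & b & Ha & Hb & ->). apply wsum_half; assumption.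
Qed.

(** There are finitely many entries, so the maximum of their depths serves for all. *)
Lemma wsum_reachable_bound one N m v : wsum (reachable one N) m v ->
  exists n, wsum (reach one N n) m v.
Proof.
  induction 1 as [|p M r m v (n & HM) H (k & IH)].
  - exists 0%nat. constructor.
  - exists (Nat.max n k). constructor.
    + eapply reach_le; [exact HM|lia].
    + eapply wsum_impl; [|exact IH]. intros M' r' H'. eapply reach_le; [exact H'|lia].
Qed.


(** * Observation and total mass *)

Lemma obs_nonnormal m N : ~ Nnf N -> obs m N = 0.
Proof.
  intros H. unfold obs.
  destruct (excluded_middle_informative (Nnf N)); [contradiction|reflexivity].
Qed.

Lemma obs_nil N : obs [] N = 0.
Proof. unfold obs. destruct (excluded_middle_informative (Nnf N)); reflexivity. Qed.

Lemma obs_cons p M m N : Nnf N ->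
  obs ((p, M) :: m) N = (if term_eq_dec M N then p else 0) + obs m N.
Proof.
  intros H. unfold obs. destruct (excluded_middle_informative (Nnf N)); [|tauto].
  reflexivity.
Qed.

(** What is already observed corresponds to trees of depth 0: value 1 on [N], and 0 on every other
    entry. *)
Lemma wsum_obs one m N : Nnf N -> wsum (reachable one N) m (obs m N).
Proof.
  intros HN. induction m as [|[p M] m IH].
  - rewrite obs_nil. constructor.
  - rewrite obs_cons by exact HN. destruct (term_eq_dec M N) as [->|_].
    + rewrite <- (Rmult_1_r p) at 2. constructor; [|exact IH]. exists 0%nat; constructor.
    + replace 0 with (p * 0) by lra. constructor; [|exact IH]. exists 0%nat; constructor.
Qed.

Definition nonneg (m : mdist) : Prop := Forall (fun pM => 0 <= fst pM) m.

(** Only an inequality, since [N] itself may be cut off with value 0; nonnegative weights turn this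
    into a loss. *)
Lemma wsum_reach_O_obs one N m v : Nnf N -> nonneg m ->
  wsum (reach one N 0) m v -> v <= obs m N.
Proof.
  intros HN Hm H. induction H as [|p M r m v HM H IH].
  - rewrite obs_nil. lra.
  - inversion Hm as [|? ? Hp Hm']; subst. simpl in Hp. specialize (IH Hm').
    rewrite obs_cons by exact HN.
    inversion HM; subst; destruct (term_eq_dec _ _); try contradiction; lra.
Qed.

Lemma obs_le_mass m N : nonneg m -> obs m N <= mass m.
Proof.
  intros Hm. destruct (classic (Nnf N)) as [HN|HN].
  - induction Hm as [|[p M] m Hp Hm IH].
    + rewrite obs_nil. unfold mass. simpl. lra.
    + rewrite obs_cons by exact HN. change (mass ((p, M) :: m)) with (p + mass m).
      simpl in Hp. destruct (term_eq_dec M N); lra.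
  - rewrite obs_nonnormal by exact HN.
    induction Hm as [|[p M] m Hp Hm IH]; [unfold mass; simpl; lra|].
    change (mass ((p, M) :: m)) with (p + mass m). simpl in Hp. lra.
Qed.

Lemma mass_app m1 m2 : mass (m1 ++ m2) = mass m1 + mass m2.
Proof.
  unfold mass. induction m1 as [|[p M] m1 IH]; simpl; [lra|]. rewrite IH. lra.
Qed.

Lemma mass_scale p m : mass (scale p m) = p * mass m.
Proof.
  unfold mass. induction m as [|[q M] m IH]; simpl; [lra|]. rewrite IH. lra.
Qed.

Lemma mass_perm m m' : Permutation m m' -> mass m = mass m'.
Proof. unfold mass. induction 1; simpl; lra. Qed.

Lemma lift_step_nonneg_mass M mi : lift_one false step M mi ->
  nonneg mi /\ mass mi = 1.
Proof.
  intros [[-> _]|H].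
  - split; [repeat constructor; simpl; lra|unfold mass; simpl; lra].
  - apply step_iff in H as [(M' & _ & ->)|(P & Q & _ & ->)];
      (split; [repeat constructor; simpl; lra|unfold mass; simpl; lra]).
Qed.

Lemma Step_nonneg_mass m m' : Step m m' -> nonneg m ->
  nonneg m' /\ mass m' = mass m.
Proof.
  intros (ms & Hms & Hp) Hm. rewrite (mass_perm _ _ Hp).
  enough (nonneg (combine_scaled m ms) /\ mass (combine_scaled m ms) = mass m) as [H1 H2]
    by (split; [eapply Permutation_Forall; [apply Permutation_sym, Hp|exact H1]|exact H2]).
  clear Hp. induction Hms as [|[p M] mi m ms HM Hms IH]; simpl.
  - split; [constructor|reflexivity].
  - inversion Hm as [|? ? Hpp Hm']; subst. simpl in Hpp, HM.
    destruct (IH Hm') as [H1 H2].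
    destruct (lift_step_nonneg_mass _ _ HM) as [H3 H4]. split.
    + apply Forall_app. split; [|exact H1].
      apply Forall_map. eapply Forall_impl; [|exact H3].
      intros [q Q] Hq; simpl in *. apply Rmult_le_pos; assumption.
    + rewrite mass_app, mass_scale, H2, H4.
      change (mass ((p, M) :: m)) with (p + mass m). lra.
Qed.

Lemma EStep_Step m m' : EStep m m' -> Step m m'.
Proof.
  intros (ms & Hms & Hp). exists ms. split; [|exact Hp].
  eapply Forall2_impl; [|exact Hms].
  intros [p M] mi [[-> _]|H]; [left|right; apply estep_step, H].
  split; [reflexivity|discriminate].
Qed.

(** Normal entries stay and all others have an E-step, so no multi-distribution is [EStep]-normal
    and maximal E-sequences never stop. *)
Lemma EStep_exists m : exists m', EStep m m'.
Proof.
  enough (exists ms, Forall2 (fun pM mi => lift_one true estep (snd pM) mi) m ms)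
    as (ms & Hms) by (exists (combine_scaled m ms), ms; split; auto).
  induction m as [|[p M] m (ms & IH)]; [exists []; constructor|].
  destruct (classic (Nnf M)) as [HM|HM].
  - exists (dirac M :: ms). constructor; [left|exact IH]. auto.
  - destruct (estep_exists _ HM) as (mi & Hmi).
    exists (mi :: ms). constructor; [right; exact Hmi|exact IH].
Qed.

(** * Maximal sequences and comparison of their limits *)

Lemma max_seq_EStep m s : max_seq EStep m s -> forall n, EStep (s n) (s (S n)).
Proof.
  intros [_ H] n. destruct (H n) as [Hn|[Hn _]]; [exact Hn|].
  destruct (Hn (EStep_exists _)).
Qed.

Lemma max_seq_EStep_Step m s : max_seq EStep m s -> max_seq Step m s.
Proof.
  intros H. split; [apply H|]. intros n. left.
  apply EStep_Step, (max_seq_EStep _ _ H).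
Qed.

Lemma max_seq_EStep_exists m : exists s, max_seq EStep m s.
Proof.
  pose (next x := proj1_sig (constructive_indefinite_description _ (EStep_exists x))).
  exists (fun n => Nat.iter n next m). split; [reflexivity|].
  intros n. left. simpl. apply proj2_sig.
Qed.

Lemma max_seq_Step_inv m t : max_seq Step m t ->
  forall n v N, wsum (reachable beta N) (t n) v -> wsum (reachable beta N) m v.
Proof.
  intros [<- Ht] n. induction n as [|n IH]; intros v N Hv; [exact Hv|].
  apply IH. destruct (Ht n) as [Hn|[_ Hn]].
  - eapply Step_pull; eassumption.
  - rewrite <- Hn. exact Hv.
Qed.

Lemma EStep_seq_nonneg_mass m s : nonneg m -> max_seq EStep m s ->
  forall n, nonneg (s n) /\ mass (s n) = mass m.
Proof.
  intros Hm Hs n. induction n as [|n [IH1 IH2]].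
  - destruct Hs as [-> _]. auto.
  - rewrite <- IH2. apply Step_nonneg_mass; [|exact IH1].
    apply EStep_Step, (max_seq_EStep _ _ Hs).
Qed.

(** The observation at [t n] is pulled back to [m], standardized into E-trees of a common depth [k],
    and pushed along [k] steps of [s], where depth 0 remains. *)
Lemma EStep_seq_dominates m t s : nonneg m -> max_seq Step m t -> max_seq EStep m s ->
  forall n N, exists k, obs (t n) N <= obs (s k) N.
Proof.
  intros Hm Ht Hs n N. destruct (classic (Nnf N)) as [HN|HN].
  2: { exists 0%nat. rewrite !obs_nonnormal by exact HN. lra. }
  assert (H := max_seq_Step_inv _ _ Ht n _ _ (wsum_obs beta (t n) N HN)).
  apply wsum_impl with (Y := reachable ebeta N) in H.
  2: { intros M r (j & Hj). eapply std_reach; [exact HN|exact Hj|apply std_refl]. }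
  apply wsum_reachable_bound in H as (k & Hk). exists k.
  apply wsum_reach_O_obs with (one := ebeta);
    [exact HN|apply (EStep_seq_nonneg_mass m); assumption|].
  replace m with (s 0%nat) in Hk by apply Hs.
  (* The remaining depth [j] is generalized so that each of the [i] steps can consume one unit; the
     case used is [i = k], [j = 0]. *)
  enough (forall i j, wsum (reach ebeta N (i + j)) (s 0%nat) (obs (t n) N) ->
                      wsum (reach ebeta N j) (s i) (obs (t n) N)) as He
    by (apply He; rewrite Nat.add_0_r; exact Hk).
  clear k Hk. induction i as [|i IH]; intros j Hj; [exact Hj|].
  eapply EStep_push; [exact HN|apply (max_seq_EStep _ _ Hs)|].
  apply IH. rewrite Nat.add_succ_r. exact Hj.
Qed.

(** Mass is conserved along the sequence, so the mass of [m] bounds all observations and the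
    pointwise suprema exist. *)
Lemma obs_rel_EStep_exists m : nonneg m -> exists r, obs_rel EStep m r.
Proof.
  intros Hm. destruct (max_seq_EStep_exists m) as (s & Hs).
  assert (HB : forall N, bound (fun x => exists n, x = obs (s n) N)).
  { intros N. exists (mass m). intros x (n & ->).
    destruct (EStep_seq_nonneg_mass _ _ Hm Hs n) as [H1 <-].
    apply obs_le_mass, H1. }
  exists (fun N => proj1_sig (completeness _ (HB N) (ex_intro _ _ (ex_intro _ 0%nat eq_refl)))).
  exists s. split; [exact Hs|]. intros N. apply proj2_sig.
Qed.

Lemma obs_rel_EStep_Step m r : obs_rel EStep m r -> obs_rel Step m r.
Proof.
  intros (s & Hs & Hr). exists s. auto using max_seq_EStep_Step.
Qed.

Lemma obs_rel_Step_le_EStep m q r : nonneg m ->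
  obs_rel Step m q -> obs_rel EStep m r -> sub_le q r.
Proof.
  intros Hm (t & Ht & Hq) (s & Hs & Hr) N. apply (Hq N). intros x (n & ->).
  destruct (EStep_seq_dominates _ _ _ Hm Ht Hs n N) as (k & Hk).
  eapply Rle_trans; [exact Hk|]. apply (Hr N). eauto.
Qed.

(** E-sequences are also [Step]-sequences, so domination applies in both directions. *)
Lemma obs_rel_EStep_unique m q r : nonneg m ->
  obs_rel EStep m q -> obs_rel EStep m r -> q = r.
Proof.
  intros Hm Hq Hr. apply functional_extensionality. intros N.
  apply Rle_antisym; eapply obs_rel_Step_le_EStep;
    eauto using obs_rel_EStep_Step.
Qed.

Lemma valid_nonneg m : valid_mdist m -> nonneg m.
Proof.
  intros [H _]. eapply Forall_impl; [|exact H]. simpl. intros; lra.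
Qed.

Theorem mainTheorem11 :
  (forall m : mdist, valid_mdist m ->
     exists d : subdist, denot m d /\
       (forall r : subdist, is_subdist r -> (obs_rel EStep m r <-> r = d)))
  /\ obs_normalizing EStep Step.
Proof.
  split.
  - intros m Hm. apply valid_nonneg in Hm.
    destruct (obs_rel_EStep_exists m Hm) as (d & Hd). exists d. split; [split|].
    + apply obs_rel_EStep_Step, Hd.
    + intros q Hq. eapply obs_rel_Step_le_EStep; eassumption.
    + intros r _. split.
      * intros Hr. eapply obs_rel_EStep_unique; eassumption.
      * intros ->. exact Hd.
  - split; [exact EStep_Step|]. split.
    + intros m Hm q Hq. apply valid_nonneg in Hm.
      destruct (obs_rel_EStep_exists m Hm) as (p & Hp).
      exists p. split; [exact Hp|]. eapply obs_rel_Step_le_EStep; eassumption.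
    (* The limit set of [EStep] has at most one element, so each of its elements is maximal. *)
    + intros m Hm p Hp p' Hp' _. apply valid_nonneg in Hm.
      eapply obs_rel_EStep_unique; eassumption.
Qed.
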